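(* Let $G$ be a finite group, $A=F[G]$, $N$ a normal subgroup of $G$, $J=J(F[N])$ and $I=\{\alpha\in F[G]\mid J\alpha=0\}$. Then there exist no projective simple $F[N]$-modules if and only if $I\subseteq J(A)$.
   Context: $F$ is a field of characteristic $p>0$ that is a splitting field for the groups considered. $J(R)$ denotes the Jacobson radical of a ring $R$. *)

(* Defs.v *)
From HB Require Import structures.
From mathcomp Require Import all_boot all_order all_algebra all_fingroup.
From mathcomp Require Import all_solvable all_field all_character.
From mathcomp Require Import boolp classical_sets.

Set Implicit Arguments.
Unset Strict Implicit.
Unset Printing Implicit Defensive.

Import GRing.Theory.
Local Open Scope ring_scope.
Local Open Scope classical_set_scope.

(** The group algebra F[H]: the element \sum_h a_h h is its coefficient
    function.  It is a separate constant because MathComp equips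
    {ffun H -> F} with the pointwise product, whereas the product here is
    convolution. *)
Definition galg (F : fieldType) (H : finGroupType) : Type := {ffun H -> F}.

Section GroupAlgebra.
Variables (F : fieldType) (H : finGroupType).

HB.instance Definition _ := GRing.Lmodule.copy (galg F H) {ffun H -> F^o}.

Implicit Types a b c : galg F H.

Definition galg_one : galg F H := [ffun h => (h == 1%g)%:R].

Definition galg_mul a b : galg F H :=
  [ffun g => \sum_(h : H) a h * b (h^-1 * g)%g].

Lemma galg_mulA : associative galg_mul.
Proof.
move=> a b c; apply/ffunP=> g; rewrite !ffunE.
transitivity (\sum_(h : H) \sum_(k : H) a h * b (h^-1 * k)%g * c (k^-1 * g)%g).
  apply: eq_bigr => h _; rewrite ffunE big_distrr /=.
  rewrite (reindex_inj (mulgI h^-1%g)) /=; apply: eq_bigr => k _.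
  by rewrite mulrA invMg invgK -!mulgA mulKVg.
rewrite exchange_big /=; apply: eq_bigr => k _.
by rewrite ffunE big_distrl.
Qed.

Lemma galg_mul1r : left_id galg_one galg_mul.
Proof.
move=> a; apply/ffunP=> g; rewrite ffunE (bigD1 1%g) //= big1 => [|h /negPf n1].
  by rewrite ffunE eqxx mul1r invg1 mul1g addr0.
by rewrite ffunE n1 mul0r.
Qed.

Lemma galg_mulr1 : right_id galg_one galg_mul.
Proof.
move=> a; apply/ffunP=> g; rewrite ffunE (bigD1 g) //= big1 => [|h /negPf n1].
  by rewrite ffunE mulVg eqxx mulr1 addr0.
by rewrite ffunE -eq_mulVg1 n1 mulr0.
Qed.

Lemma galg_mulDl : left_distributive galg_mul +%R.
Proof.
move=> a b c; apply/ffunP=> g; rewrite !ffunE -big_split /=.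
by apply: eq_bigr => h _; rewrite ffunE mulrDl.
Qed.

Lemma galg_mulDr : right_distributive galg_mul +%R.
Proof.
move=> a b c; apply/ffunP=> g; rewrite !ffunE -big_split /=.
by apply: eq_bigr => h _; rewrite ffunE mulrDr.
Qed.

Lemma galg_oner_neq0 : galg_one != 0.
Proof.
by apply/eqP=> /ffunP/(_ 1%g); rewrite !ffunE eqxx => /eqP; rewrite oner_eq0.
Qed.

HB.instance Definition _ := GRing.Zmodule_isNzRing.Build (galg F H)
  galg_mulA galg_mul1r galg_mulr1 galg_mulDl galg_mulDr galg_oner_neq0.

Lemma galgZE (k : F) a (g : H) : (k *: a) g = k * a g.
Proof. by rewrite ffunE. Qed.

Lemma galgME a b (g : H) : (a * b) g = \sum_(h : H) a h * b (h^-1 * g)%g.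
Proof. by rewrite ffunE. Qed.

Lemma galg_scalerAl (k : F) a b : k *: (a * b) = k *: a * b.
Proof.
apply/ffunP=> g; rewrite galgZE !galgME big_distrr /=.
by apply: eq_bigr => h _; rewrite galgZE mulrA.
Qed.

HB.instance Definition _ :=
  GRing.Lmodule_isLalgebra.Build F (galg F H) galg_scalerAl.

Lemma galg_scalerAr (k : F) a b : k *: (a * b) = a * (k *: b).
Proof.
apply/ffunP=> g; rewrite galgZE !galgME big_distrr /=.
by apply: eq_bigr => h _; rewrite galgZE mulrCA.
Qed.

HB.instance Definition _ :=
  GRing.Lalgebra_isAlgebra.Build F (galg F H) galg_scalerAr.

End GroupAlgebra.

(** The inclusion F[N] -> F[G] for N \subset G: extension by zero.  The
    projection [subg N : gT -> [subg N]] is only used on elements of N. *)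
Definition galg_incl (F : fieldType) (gT : finGroupType) (N G : {group gT})
    (a : galg F [subg N]) : galg F [subg G] :=
  [ffun g => if sgval g \in N then a (subg N (sgval g)) else 0].

Lemma galg_inclE (F : fieldType) (gT : finGroupType) (N G : {group gT})
    (a : galg F [subg N]) (g : [subg G]) :
  galg_incl G a g = if sgval g \in N then a (subg N (sgval g)) else 0.
Proof. by rewrite ffunE. Qed.

Lemma galg_incl_linear (F : fieldType) (gT : finGroupType) (N G : {group gT}) :
  linear (@galg_incl F gT N G).
Proof.
move=> k a b; apply/ffunP=> g; rewrite galg_inclE [RHS]ffunE.
rewrite galgZE !galg_inclE; case: ifP => _; last by rewrite mulr0 addr0.
by rewrite ffunE galgZE.
Qed.

Lemma galg_incl_monoid_morphism (F : fieldType) (gT : finGroupType)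
    (N G : {group gT}) : N \subset G -> monoid_morphism (@galg_incl F gT N G).
Proof.
move=> sNG; split=> [|a b]; apply/ffunP=> g; rewrite galg_inclE.
  rewrite !ffunE -!val_eqE /=; case: ifP => [Ng|]; first by rewrite subgK.
  by case: eqP => // ->; rewrite group1.
rewrite [RHS]galgME [RHS](bigID (fun h : [subg G] => sgval h \in N)) /=.
rewrite [X in _ = _ + X]big1 => [|h /negPf Nh]; last first.
  by rewrite galg_inclE Nh mul0r.
rewrite addr0; case: ifP => Ng; last first.
  rewrite big1 // => h Nh; rewrite !galg_inclE /= groupMl ?groupV // Ng.
  by rewrite mulr0.
rewrite galgME (reindex_onto (fun x : [subg N] => subg G (sgval x))
                             (fun h : [subg G] => subg N (sgval h))) /=.
  apply: eq_big => [x|x _]; have Gx := fintype.subsetP sNG _ (subgP x).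
    by rewrite subgK // subgP sgvalK eqxx.
  rewrite !galg_inclE /= subgK // subgP sgvalK groupMl ?groupV ?subgP // Ng.
  by congr (_ * b _); apply: val_inj; rewrite /= !subgK ?groupM ?groupV ?subgP.
by move=> h Nh; rewrite subgK // sgvalK.
Qed.

Lemma galg_incl_inj (F : fieldType) (gT : finGroupType) (N G : {group gT}) :
  N \subset G -> injective (@galg_incl F gT N G).
Proof.
move=> sNG a b /ffunP eq_ab; apply/ffunP=> x.
have Gx := fintype.subsetP sNG _ (subgP x); have := eq_ab (subg G (sgval x)).
by rewrite !galg_inclE subgK // subgP sgvalK.
Qed.

(** Modules over a ring R are left modules, as in MathComp's [lmodType R]. *)

Section RingNotions.
Variable R : pzRingType.

Definition submodule (M : lmodType R) (S : set M) : Prop :=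
  submod_closed (mem S).

Definition simple_module (M : lmodType R) : Prop :=
  (exists x : M, x <> 0) /\
  forall S : set M, submodule S -> S = [set 0] \/ S = setT.

Definition projective_module (P : lmodType R) : Prop :=
  forall (U V : lmodType R) (f : {linear U -> V}) (g : {linear P -> V}),
    range f = setT -> exists h : {linear P -> U}, forall x, f (h x) = g x.

Definition left_ideal (L : set R) : Prop := @submodule R^o L.

Definition maximal_left_ideal (L : set R) : Prop :=
  [/\ left_ideal L, L <> setT &
      forall L' : set R, left_ideal L' -> L `<=` L' -> L' = L \/ L' = setT].

Definition jacobson_radical : set R :=
  \bigcap_(L in [set L | maximal_left_ideal L]) L.

End RingNotions.

Arguments jacobson_radical R : clear implicits.

(** The right annihilator in F[G] of a subset of the subalgebra F[N]. *)
Definition right_annihilator (F : fieldType) (gT : finGroupType)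
    (N G : {group gT}) (J : set (galg F [subg N])) : set (galg F [subg G]) :=
  [set a | forall b, J b -> galg_incl G b * a = 0].

Arguments right_annihilator {F gT N} G J.

(* Main.v *)
Require Import Defs.
From HB Require Import structures.
From mathcomp Require Import all_boot all_order all_algebra all_fingroup.
From mathcomp Require Import all_solvable all_field all_character.
From mathcomp Require Import boolp classical_sets.

Set Implicit Arguments.
Unset Strict Implicit.
Unset Printing Implicit Defensive.

Import GRing.Theory.
Local Open Scope ring_scope.
Local Open Scope classical_set_scope.

(** Let B = F[N], A = F[G] and let S be the right annihilator of J = J(B) in B.
    A projective simple B-module is isomorphic to B e for a nonzero idempotent e
    with J e = 0; this e lies in I but cannot lie in J(A).  Conversely, if S is
    not contained in J, then a minimal principal left ideal among those generated
    by an element of S \ J is B e for an idempotent e, and it is simple because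
    J S = 0.  If on the other hand S lies in J, then S S = 0; since I is a left
    ideal (J is stable under conjugation by G) and I = S A (split along the
    cosets of N), this yields I I = 0, hence I is contained in J(A). *)

(** * Left ideals and the Jacobson radical *)

Lemma submoduleP (R : pzRingType) (M : lmodType R) (S : set M) :
  submodule S <-> S 0 /\ forall a u v, S u -> S v -> S (a *: u + v).
Proof.
split=> -[S0 Sl]; split; try exact/mem_set; try exact: set_mem.
  by move=> a u v Su Sv; apply/set_mem/Sl; exact/mem_set.
by move=> a u v /set_mem Su /set_mem Sv; apply/mem_set/Sl.
Qed.

Section Jacobson.
Variable R : pzRingType.
Implicit Types (r u x y : R) (L : set R).

Lemma left_idealP L :
  left_ideal L <-> L 0 /\ forall r x y, L x -> L y -> L (r * x + y).
Proof. exact: submoduleP. Qed.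

Lemma left_idealM L r x : left_ideal L -> L x -> L (r * x).
Proof. by move=> /left_idealP[L0 Ll] Lx; rewrite -[r * x]addr0; apply: Ll. Qed.

Lemma left_ideal_setT L : left_ideal L -> L 1 -> L = setT.
Proof.
move=> idL L1; rewrite -subTset => x _; rewrite -[x]mulr1.
exact: left_idealM.
Qed.

Lemma principal_left_ideal x : left_ideal [set r * x | r in [set: R]].
Proof.
apply/left_idealP; split=> [|r _ _ [s _ <-] [t _ <-]].
  by exists 0 => //; rewrite mul0r.
by exists (r * s + t) => //; rewrite mulrDl mulrA.
Qed.

Lemma exists_maximal_left_ideal x :
  ~ (exists u, u * x = 1) -> exists2 L, maximal_left_ideal L & L x.
Proof.
move=> nx.
pose P : set (set R) := [set L | L = set0 \/ [/\ left_ideal L, L x & ~ L 1]].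
have [F FP Ftot|A [PA Amax]] := @Zorn_bigcup R P.
  case: (pselect (exists2 X, F X & X !=set0)) => [[X FX [y Xy]]|F0]; last first.
    left; apply/eqP; apply: contra_notT F0 => /set0P[y [X FX Xy]].
    by exists X => //; exists y.
  right; have idF Y z : F Y -> Y z -> [/\ left_ideal Y, Y x & ~ Y 1].
    by move=> FY Yz; case: (FP Y FY) => // Y0; rewrite Y0 in Yz.
  have [idX Xx _] := idF X y FX Xy; split; last 2 first.
  - by exists X.
  - by case=> Y FY Y1; have [] := idF Y 1 FY Y1.
  apply/left_idealP; split=> [|r a b [Y FY Ya] [Z FZ Zb]].
    by exists X => //; case/left_idealP: idX.
  have [/left_idealP[_ Yl] _ _] := idF Y a FY Ya.
  have [/left_idealP[_ Zl] _ _] := idF Z b FZ Zb.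
  have [YZ|ZY] := Ftot Y Z FY FZ.
    by exists Z => //; apply: Zl => //; exact: YZ.
  by exists Y => //; apply: Yl => //; exact: ZY.
have [idA Ax nA1] : [/\ left_ideal A, A x & ~ A 1].
  case: PA => // A0; have xx : [set r * x | r in [set: R]] x.
    by exists 1 => //; rewrite mul1r.
  case: (Amax [set r * x | r in [set: R]]).
    by rewrite A0; split=> // /(_ x xx).
  right; split=> //; first exact: principal_left_ideal.
  by case=> u _ ux; apply: nx; exists u.
exists A => //; split=> // [AT|L idL AL]; first by apply: nA1; rewrite AT.
case: (pselect (L 1)) => [L1|nL1]; first by right; exact: left_ideal_setT.
left; apply/seteqP; split=> //; apply: contrapT => nLA.
by apply: (Amax L); [split|right; split=> //; exact: AL].
Qed.

(** If [1 - r * x] has no left inverse, some maximal left ideal contains it; this ideal also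
    contains [x], hence [1]. Conversely, if a maximal [L] misses [x], then [R x + L = R] puts some
    left invertible [1 - r * x] in [L]. *)
Lemma jacobsonP x :
  jacobson_radical R x <-> forall r, exists u, u * (1 - r * x) = 1.
Proof.
split=> [Jx r|Ux L [idL LnT Lmax]].
  apply: contrapT => /exists_maximal_left_ideal[L maxL Lrx].
  have [idL LnT _] := maxL; apply/LnT/left_ideal_setT => //.
  have /left_idealP[_ Ll] := idL.
  by rewrite -[1](subrK (r * x)) addrC; apply: Ll => //; exact: Jx.
apply: contrapT => nLx.
pose L' : set R := [set r * x + y | r in [set: R] & y in L].
have /left_idealP[L0 Ll] := idL.
have idL' : left_ideal L'.
  apply/left_idealP; split=> [|r _ _ [s _ [y Ly <-]] [t _ [z Lz <-]]].
    by exists 0 => //; exists 0 => //; rewrite mul0r addr0.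
  exists (r * s + t) => //; exists (r * y + z); first exact: Ll.
  by rewrite mulrDl mulrDr -!mulrA addrACA.
have LL' : L `<=` L'.
  by move=> y Ly; exists 0 => //; exists y => //; rewrite mul0r add0r.
have [eqL|eqT] := Lmax L' idL' LL'.
  apply: nLx; rewrite -eqL; exists 1 => //; exists 0 => //.
  by rewrite mul1r addr0.
have [r _ [y Ly rxy]] : L' 1 by rewrite eqT.
have [u u1] := Ux r; apply: LnT; apply: left_ideal_setT => //.
by rewrite -u1 -rxy addrC addKr; exact: left_idealM.
Qed.

Lemma jacobsonMl r x : jacobson_radical R x -> jacobson_radical R (r * x).
Proof.
by move=> /jacobsonP Ux; apply/jacobsonP => s; rewrite mulrA; exact: Ux.
Qed.

(* If u is a left inverse of 1 - b a, then 1 + a u b is one of 1 - a b. *)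
Lemma jacobsonMr x r : jacobson_radical R x -> jacobson_radical R (x * r).
Proof.
move=> /jacobsonP Ux; apply/jacobsonP => s; have [u u1] := Ux (r * s).
exists (1 + s * x * u * r).
have urr : u * (r * (1 - s * (x * r))) = r.
  rewrite -[RHS]mul1r -[X in _ = X * r]u1 -mulrA; congr (_ * _).
  by rewrite mulrBr mulrBl mulr1 mul1r -!mulrA.
by rewrite mulrDl mul1r -(mulrA _ r) -(mulrA _ u) urr -(mulrA s) subrK.
Qed.

Lemma jacobson_idempotent e : jacobson_radical R e -> e * e = e -> e = 0.
Proof.
move=> /jacobsonP/(_ 1)[u u1] ee; rewrite -[e]mul1r -u1 -mulrA mul1r.
by rewrite mulrBl mul1r ee subrr mulr0.
Qed.

Lemma jacobson_square_zero x :
  (forall r, r * x * (r * x) = 0) -> jacobson_radical R x.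
Proof.
move=> x2; apply/jacobsonP => r; exists (1 + r * x).
by rewrite mulrDl mul1r mulrBr mulr1 x2 subr0 subrK.
Qed.

(** For [y = r * x], the factorization [1 - y * y = (1 + y) * (1 - y)] turns a left inverse of
    [1 - y * y] into one of [1 - y]. *)
Lemma not_jacobson_square x :
  ~ jacobson_radical R x ->
  exists r, ~ jacobson_radical R (r * x * (r * x)).
Proof.
move=> nJx; apply: contrapT => nr; apply: nJx; apply/jacobsonP => r.
have /jacobsonP/(_ 1)[u u1] : jacobson_radical R (r * x * (r * x)).
  by apply: contrapT => nJ; apply: nr; exists r.
exists (u * (1 + r * x)); rewrite -mulrA -[RHS]u1 mul1r; congr (_ * _).
by rewrite mulrDl mul1r mulrBr mulr1 addrA subrK.
Qed.

End Jacobson.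

Lemma jacobson_morph (R R' : pzRingType) (f : {rmorphism R -> R'}) x :
  (forall y, exists x, f x = y) -> jacobson_radical R x ->
  jacobson_radical R' (f x).
Proof.
move=> surf /jacobsonP Ux; apply/jacobsonP => r'.
have [r <-] := surf r'; have [u u1] := Ux r; exists (f u).
by rewrite -rmorphM -(rmorph1 f) -rmorphB -rmorphM u1.
Qed.

(** * Simple projective modules and idempotents *)

Section ActOn.
Variables (R : pzRingType) (M : lmodType R) (x : M).

Definition act_on (r : R^o) : M := (r : R) *: x.

Lemma act_on_linear : linear act_on.
Proof. by move=> a r s; rewrite /act_on scalerDl scalerA. Qed.

HB.instance Definition _ :=
  GRing.isLinear.Build R R^o M *:%R act_on act_on_linear.

End ActOn.

Section FixedModule.
Variables (R : pzRingType) (e : R).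

(* When e is idempotent, these are the elements of the left ideal R e. *)
Definition fixed_by : {pred R^o} := fun x : R => x * e == x.

Lemma fixed_by_closed : submod_closed fixed_by.
Proof.
split=> [|r x y /eqP xe /eqP ye]; rewrite unfold_in; first by rewrite mul0r.
by rewrite -[r *: x]/(r * x) mulrDl -mulrA xe ye.
Qed.

HB.instance Definition _ :=
  GRing.isSubmodClosed.Build R R^o fixed_by fixed_by_closed.

Record fixed_module : Type :=
  FixedModule { fixed_val : R^o; _ : fixed_val \in fixed_by }.

HB.instance Definition _ := [isSub for fixed_val].
HB.instance Definition _ := [Choice of fixed_module by <:].
HB.instance Definition _ := [SubChoice_isSubLmodule of fixed_module by <:].

Lemma fixed_valM (x : fixed_module) : (fixed_val x : R) * e = fixed_val x.
Proof. exact/eqP/(valP x). Qed.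

Hypothesis ee : e * e = e.

(** A linear map out of [R e] is determined by the image of [e]: if [u] lifts [g e], then
    [x |-> x u] lifts [g], because [x e = x]. *)
Lemma fixed_module_projective : projective_module fixed_module.
Proof.
move=> U V f g fT; pose e' : fixed_module := FixedModule (introT eqP ee).
have [u _ fu] : range f (g e') by rewrite fT.
pose h (x : fixed_module) : U := (fixed_val x : R) *: u.
have hl : linear h by move=> a x y; rewrite /h /= scalerDl scalerA.
pose hL := GRing.isLinear.Build R fixed_module U *:%R h hl.
exists (HB.pack_for {linear fixed_module -> U} h hL) => x /=.
rewrite /h linearZ fu -linearZ; congr (g _); apply: val_inj => /=.
exact: fixed_valM.
Qed.

Lemma fixed_module_simple :
  e <> 0 -> (forall x, x * e = x -> x <> 0 -> exists d, d * x = e) ->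
  simple_module fixed_module.
Proof.
move=> e0 gen; pose e' : fixed_module := FixedModule (introT eqP ee).
split=> [|S /submoduleP[S0 Sl]].
  by exists e' => /(congr1 val); exact: e0.
case: (pselect (exists2 x, S x & x <> 0)) => [[x Sx xn0]|nS]; last first.
  left; apply/seteqP; split=> [x Sx|_ -> //]; apply: contrapT => xn0.
  by apply: nS; exists x.
right; rewrite -subTset => y _.
have [|d dx] := gen (fixed_val x) (fixed_valM x).
  by move=> x0; apply: xn0; exact: val_inj.
suff -> : y = ((fixed_val y : R) * d) *: x + 0 by exact: Sl.
by apply: val_inj; rewrite addr0 /= /GRing.scale /= -mulrA dx fixed_valM.
Qed.

End FixedModule.

(** For [x <> 0] the surjection [r |-> r x] from [R] to [M] has a section [h]. Then [e = h x]
    satisfies [e x = x], and applying [h] gives [e e = e]. *)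
Lemma simple_projective_idempotent (R : pzRingType) (M : lmodType R) :
  simple_module M -> projective_module M ->
  exists e : R, [/\ e * e = e, e <> 0 &
                    forall j, jacobson_radical R j -> j * e = 0].
Proof.
move=> [[x xn0] simM] projM.
have rangeT (y : M) : y <> 0 -> range (act_on y) = setT.
  move=> yn0; case: (simM (range (act_on y))) => // [|r0].
    apply/submoduleP; split=> [|a _ _ [r _ <-] [s _ <-]].
      by exists 0 => //; rewrite linear0.
    by exists (a *: r + s) => //; rewrite linearP.
  have : range (act_on y) y by exists 1 => //; exact: scale1r.
  by rewrite r0 => /yn0.
have [h fh] := projM _ _ (act_on x) idfun (rangeT x xn0).
have hx : (h x : R) *: x = x := fh x.
exists (h x); split.
- by rewrite -[RHS](congr1 h hx) linearZ.
- by move=> hx0; apply: xn0; rewrite -hx hx0 scale0r.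
move=> j /jacobsonP Uj.
have -> : j * h x = h (j *: x) by rewrite linearZ.
(* Nakayama's argument: if [j x] were nonzero, simplicity would give [r j x = x], so the left
   invertible [1 - r j] would kill [x]. *)
apply: contrapT => hn0; have jxn0 : j *: x <> 0.
  by move=> jx0; apply: hn0; rewrite jx0 linear0.
have [r _ rjx] : range (act_on (j *: x)) x by rewrite rangeT.
have [u u1] := Uj r; apply: xn0.
rewrite -[x]scale1r -u1 -scalerA scalerBl scale1r -scalerA.
by rewrite -[X in X - _]rjx subrr scaler0.
Qed.

(** The first hypothesis is the descending chain condition on principal left ideals, stated as a
    minimum condition on generators. *)
Lemma annihilator_sub_jacobson (R : pzRingType) :
  (forall P : set R, P !=set0 -> exists2 x, P x &
     forall r, P (r * x) -> exists s, s * (r * x) = x) ->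
  (forall M : lmodType R, ~ (simple_module M /\ projective_module M)) ->
  forall s : R, (forall j, jacobson_radical R j -> j * s = 0) ->
  jacobson_radical R s.
Proof.
set J := jacobson_radical R.
pose S : set R := [set s | forall j, J j -> j * s = 0].
move=> dcc noM s Ss; apply: contrapT => nJs.
have SM r x : S x -> S (r * x).
  by move=> Sx j Jj; rewrite mulrA; apply: Sx; exact: jacobsonMr.
have [|x [Sx nJx] xmin] := dcc [set x | S x /\ ~ J x]; first by exists s.
have [r] := not_jacobson_square nJx; set l := r * x => nJll.
have [c cx] : exists c, c * (l * l) = x.
  rewrite [l * l]mulrA; apply: xmin; rewrite -mulrA; split=> //.
  exact: (SM _ _ (SM _ _ Sx)).
(* Chosen to fix [l] from the left: [r c l l = r x = l]. *)
pose e0 := r * c * l.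
have e0l : e0 * l = l by rewrite /e0 -(mulrA _ l) -(mulrA r) cx.
have Se0 : S e0 := SM _ _ (SM _ _ Sx).
have nll : l * l <> 0.
  move=> ll0; apply: nJll; rewrite ll0.
  by apply: jacobson_square_zero => t; rewrite mulr0 mul0r.
pose k := r * c * r; have e0E : e0 = k * x by rewrite /e0 /l mulrA.
(* Otherwise the defect, a left multiple of [x] in [S] outside [J], would generate [x] by
   minimality. Since it kills [l], so would [x], and [l l = r x l] would vanish. *)
have Jf : J (e0 * e0 - e0).
  apply: contrapT => nJf.
  have fl : (e0 * e0 - e0) * l = 0 by rewrite mulrBl -mulrA !e0l subrr.
  have fE : (e0 * k - k) * x = e0 * e0 - e0 by rewrite mulrBl -mulrA -e0E.
  have [|d dx] := xmin (e0 * k - k).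
    by rewrite fE; split=> //; rewrite -fE; exact: SM.
  apply: nll.
  by rewrite -[l * l]/(r * x * l) -dx fE -(mulrA r) -(mulrA d) fl !mulr0.
(* As J S = 0, the defect e0^2 - e0 kills e0, so e0^2 is idempotent. *)
have e03 : e0 * e0 * e0 = e0 * e0.
  by apply/eqP; rewrite -subr_eq0 -mulrBl; apply/eqP/Se0.
have ee : (e0 * e0) * (e0 * e0) = e0 * e0 by rewrite mulrA !e03.
have en0 : e0 * e0 <> 0.
  move=> ee0; apply: nll; have : e0 * e0 * l = l by rewrite -mulrA !e0l.
  by rewrite ee0 mul0r => <-; rewrite mulr0.
apply: (noM (fixed_module (e0 * e0))); split.
  (* A nonzero [y] fixed by [e0 * e0] is outside [J], as [J S = 0], and is a left multiple of [x].
     Minimality recovers [x] from [y], and then [e0 * e0 = e0 k x]. *)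
  apply: fixed_module_simple => // y ye yn0.
  have nJy : ~ J y by move=> Jy; apply: yn0; rewrite -ye; exact: (SM _ _ Se0).
  have yx : y * (e0 * k) * x = y by rewrite -2!mulrA -e0E.
  have [|d dy] := xmin (y * (e0 * k)).
    by rewrite yx; split=> //; rewrite -yx; exact: SM.
  by exists (e0 * k * d); rewrite -mulrA -[X in d * X]yx dy -mulrA -e0E.
exact: fixed_module_projective.
Qed.

(** * Group algebras as finite-dimensional algebras *)

HB.instance Definition _ (F : fieldType) (H : finGroupType) :=
  Vector.copy (galg F H) {ffun H -> F^o}.

Section GroupAlgebraTheory.
Variables (F : fieldType) (H : finGroupType).
Implicit Types (a x y : galg F H) (g h : H).

Section RightMul.
Variable x : galg F H.

Definition right_mul a : galg F H := a * x.

Lemma right_mul_linear : linear right_mul.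
Proof. by move=> k a b; rewrite /right_mul mulrDl scalerAl. Qed.

HB.instance Definition _ :=
  GRing.isLinear.Build F (galg F H) (galg F H) *:%R right_mul right_mul_linear.

End RightMul.

Lemma memv_right_mulP x y :
  reflect (exists a, a * x = y) (y \in limg (linfun (right_mul x))).
Proof.
apply: (iffP memv_imgP) => [[a _ ->]|[a <-]]; exists a.
- by rewrite lfunE.
- exact: memvf.
by rewrite lfunE.
Qed.

(** Principal left ideals are [F]-subspaces, so [x] is taken in [P] with the dimension of its ideal
    minimal; a smaller ideal generated by an element of [P] then has the same dimension and
    coincides with it. *)
Lemma galg_principal_dcc (P : set (galg F H)) : P !=set0 ->
  exists2 x, P x & forall r, P (r * x) -> exists s, s * (r * x) = x.
Proof.
move=> [x0 Px0]; pose L x := limg (linfun (right_mul x)).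
pose D (n : nat) := `[< exists2 x, P x & \dim (L x) = n >].
have exD : exists n, D n by exists (\dim (L x0)); apply/asboolP; exists x0.
case: (ex_minnP exD) => _ /asboolP[x Px <-] xmin; exists x => // r Prx.
have Lx_rx : (L (r * x)%R <= L x)%VS.
  apply/subvP=> _ /memv_right_mulP[a <-]; apply/memv_right_mulP.
  by exists (a * r); rewrite mulrA.
have /eqP LE : L (r * x) == L x.
  by rewrite eqEdim Lx_rx xmin //; apply/asboolP; exists (r * x).
apply/memv_right_mulP; rewrite -/(L _) LE; apply/memv_right_mulP.
by exists 1; rewrite mul1r.
Qed.

Definition galg_delta g : galg F H := [ffun h => (h == g)%:R].

Lemma galg_deltaMl g a h : (galg_delta g * a) h = a (g^-1 * h)%g.
Proof.
rewrite galgME (bigD1 g) //= big1 ?addr0 ?ffunE ?eqxx ?mul1r // => k /negPf kg.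
by rewrite ffunE kg mul0r.
Qed.

Lemma galg_deltaMr a g h : (a * galg_delta g) h = a (h * g^-1)%g.
Proof.
rewrite galgME (bigD1 (h * g^-1)%g) //= big1 ?addr0.
  by rewrite ffunE invMg invgK mulgKV eqxx mulr1.
move=> k /negPf kg; rewrite ffunE; case: eqP => [gE|_]; last by rewrite mulr0.
by rewrite -gE invMg invgK mulKVg eqxx in kg.
Qed.

Lemma galg_sum_delta a : a = \sum_g a g *: galg_delta g.
Proof.
apply/ffunP=> h; rewrite sum_ffunE (bigD1 h) //= big1 ?addr0.
  by rewrite galgZE ffunE eqxx mulr1.
by move=> k /negPf kh; rewrite galgZE ffunE eq_sym kh mulr0.
Qed.

End GroupAlgebraTheory.

(** * Conjugation of [F[N]] by elements normalizing [N] *)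

Section Conjugation.
Variables (F : fieldType) (gT : finGroupType) (N : {group gT}) (g : gT).
Hypothesis nNg : g \in 'N(N)%g.

(** This is [a |-> g a g^-1]. The normalizer proof is an argument so that the ring morphism
    instances below can depend on it. *)
Definition galg_conj of g \in 'N(N)%g := fun a : galg F [subg N] =>
  [ffun n => a (subg N (sgval n ^ g))] : galg F [subg N].

Let conj_mem (n : [subg N]) : (sgval n ^ g)%g \in N.
Proof. by rewrite memJ_norm // subgP. Qed.

Lemma galg_conj_zmod_morphism : zmod_morphism (galg_conj nNg).
Proof. by move=> a b; apply/ffunP=> n; rewrite !ffunE. Qed.

Lemma galg_conj_monoid_morphism : monoid_morphism (galg_conj nNg).
Proof.
split=> [|a b]; apply/ffunP=> n; rewrite ffunE.
  by rewrite !ffunE -!val_eqE /= subgK // conjg_eq1.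
rewrite !galgME.
rewrite (reindex (fun m : [subg N] => subg N (sgval m ^ g)%g)) /=.
  apply: eq_bigr => m _; rewrite !ffunE; congr (_ * b _).
  apply: val_inj; rewrite /= !(subgK _ (conj_mem _)) -conjVg -conjMg.
  by rewrite (subgK _ (conj_mem (m^-1 * n)%g)).
exists (fun m : [subg N] => subg N (sgval m ^ g^-1)%g) => m _; apply: val_inj.
  by rewrite /= !subgK ?conjgK ?subgP.
by rewrite /= !subgK ?memJ_norm ?groupV ?subgP ?conjgKV.
Qed.

HB.instance Definition _ := GRing.isZmodMorphism.Build
  (galg F [subg N]) (galg F [subg N]) (galg_conj nNg) galg_conj_zmod_morphism.
HB.instance Definition _ := GRing.isMonoidMorphism.Build
  (galg F [subg N]) (galg F [subg N]) (galg_conj nNg) galg_conj_monoid_morphism.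

Lemma galg_conj_surj b : exists a, galg_conj nNg a = b.
Proof.
exists [ffun n => b (subg N (sgval n ^ g^-1)%g)].
apply/ffunP=> n; rewrite !ffunE subgK ?conj_mem // conjgK; congr (b _).
exact: sgvalK.
Qed.

End Conjugation.

(** * [F[G]] over [F[N]]: commutation with group elements and cosets *)

Section Inclusion.
Variables (F : fieldType) (gT : finGroupType) (G N : {group gT}).
Hypothesis nsNG : (N <| G)%g.
Implicit Types (a : galg F [subg G]) (c : galg F [subg N]).

Let sNG : N \subset G := normal_sub nsNG.

Let normG (g : [subg G]) : sgval g \in 'N(N)%g.
Proof. exact: (fintype.subsetP (normal_norm nsNG)) (subgP g). Qed.

Lemma galg_incl_delta c (g : [subg G]) :
  galg_incl G c * galg_delta F g =
  galg_delta F g * galg_incl G (galg_conj (groupVr (normG g)) c).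
Proof.
apply/ffunP=> x; rewrite galg_deltaMr galg_deltaMl !galg_inclE /=.
have -> : (sgval x * (sgval g)^-1 = ((sgval g)^-1 * sgval x) ^ (sgval g)^-1)%g.
  by rewrite conjgE invgK -mulgA mulKVg.
rewrite memJ_norm ?groupV //; case: ifP => // Nx.
by rewrite ffunE subgK.
Qed.

Lemma galg_inclM c a x :
  (galg_incl G c * a) x =
  \sum_(n : [subg N]) c n * a ((subg G (sgval n))^-1 * x)%g.
Proof.
rewrite galgME (bigID (fun h : [subg G] => sgval h \in N)) /=.
rewrite [X in _ + X]big1 => [|h /negPf Nh]; last first.
  by rewrite galg_inclE Nh mul0r.
rewrite addr0 (reindex_onto (fun n : [subg N] => subg G (sgval n))
                            (fun h : [subg G] => subg N (sgval h))) /=.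
  apply: eq_big => [n|n _]; have Gn := fintype.subsetP sNG _ (subgP n).
    by rewrite subgK // subgP sgvalK eqxx.
  by rewrite galg_inclE subgK // subgP sgvalK.
by move=> h Nh; rewrite subgK // sgvalK.
Qed.

(** The part of [a] supported on the coset [N g], translated back into [F[N]] by [g^-1] on the
    right. *)
Definition coset_slice a (g : [subg G]) : galg F [subg N] :=
  [ffun n => a (subg G (sgval n) * g)%g].

Lemma coset_sliceE a :
  a = \sum_(g : [subg G] | repr (N :* sgval g)%g == sgval g)
        galg_incl G (coset_slice a g) * galg_delta F g.
Proof.
apply/ffunP=> x; rewrite sum_ffunE.
have sliceE g : (galg_incl G (coset_slice a g) * galg_delta F g) x =
    if sgval x \in (N :* sgval g)%g then a x else 0.
  rewrite galg_deltaMr galg_inclE mem_rcoset /=; case: ifP => // Nxg.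
  rewrite ffunE subgK // -[subg G _]/(subg G (sgval (x * g^-1)%g)).
  by rewrite sgvalK mulgKV.
have Nx : repr (N :* sgval x)%g \in (N :* sgval x)%g.
  exact: mem_repr (rcoset_refl _ _).
have Gx : repr (N :* sgval x)%g \in G.
  have [n Nn ->] := rcosetP Nx.
  by rewrite groupM ?subgP // (fintype.subsetP sNG).
have repE : (N :* repr (N :* sgval x) = N :* sgval x)%g by apply: rcoset_eqP.
(* Only the chosen representative of the coset of [x] contributes at [x]. *)
rewrite (bigD1 (subg G (repr (N :* sgval x)%g))) /=; last first.
  by rewrite subgK // repE.
rewrite big1 ?addr0 => [|g /andP[/eqP gE gn]].
  by rewrite sliceE subgK // repE rcoset_refl.
rewrite sliceE; case: ifP => // /rcoset_eqP xg.
by case/eqP: gn; apply: val_inj; rewrite /= subgK // xg gE.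
Qed.

(** Left multiplication by [F[N]] preserves each right coset of [N]. Hence slices of an element
    annihilated by [J] are themselves annihilated by [J]. *)
Lemma coset_slice_mul c a g :
  c * coset_slice a g = coset_slice (galg_incl G c * a) g.
Proof.
apply/ffunP=> n; rewrite galgME ffunE galg_inclM; apply: eq_bigr => m _.
rewrite ffunE; congr (_ * a _); apply: val_inj => /=.
by rewrite !subgK ?groupM ?groupV ?(fintype.subsetP sNG _ (subgP _)) // mulgA.
Qed.

End Inclusion.

Theorem corollary3p6 (F : fieldType) (p : nat) (charF : p \in [pchar F])
    (gT : finGroupType) (G N : {group gT}) (nsNG : (N <| G)%g)
    (splitG : group_splitting_field F G) (splitN : group_splitting_field F N) :
  let J : set (galg F [subg N]) := jacobson_radical (galg F [subg N]) in
  let I : set (galg F [subg G]) := right_annihilator G J in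
  (~ exists M : lmodType (galg F [subg N]),
       simple_module M /\ projective_module M)
  <-> I `<=` jacobson_radical (galg F [subg G]).
Proof.
move=> J I; have sNG := normal_sub nsNG; split=> [noM a Ia|IJ [M [simM projM]]].
  have annJ s : (forall j, J j -> j * s = 0) -> J s.
    apply: annihilator_sub_jacobson; first exact: galg_principal_dcc.
    by move=> M MP; apply: noM; exists M.
  have IM c b : I b -> I (c * b).
    move=> Ib j Jj; rewrite [c]galg_sum_delta big_distrl big_distrr.
    rewrite big1 //= => g _.
    (* Moving [j] past [g] replaces it by a conjugate, still in [J] since conjugation is a
       surjective ring morphism. *)
    rewrite -scalerAl -scalerAr mulrA (galg_incl_delta nsNG) -mulrA.
    rewrite Ib ?mulr0 ?scaler0 //.
    by apply: jacobson_morph Jj; exact: galg_conj_surj.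
  have II b c : I b -> I c -> b * c = 0.
    (* In each term the slice of [b] is killed by [J], so it lies in [J] by [annJ]; it therefore
       kills [g c], which is in [I]. *)
    move=> Ib Ic; rewrite [b](coset_sliceE nsNG) big_distrl big1 //= => g _.
    rewrite -mulrA IM //; apply: annJ => j Jj.
    by rewrite (coset_slice_mul nsNG) Ib //; apply/ffunP=> n; rewrite !ffunE.
  by apply: jacobson_square_zero => r; apply: II; exact: IM.
have [e [ee en0 Je]] := simple_projective_idempotent simM projM.
have [incl1 inclM] := galg_incl_monoid_morphism F sNG.
have incl0 : galg_incl G (0 : galg F [subg N]) = 0.
  by apply/ffunP=> g; rewrite galg_inclE !ffunE; case: ifP.
(* The image of [e] in [F[G]] is an idempotent of [I], hence of the radical, so it is zero. *)
apply: en0; apply: (galg_incl_inj sNG); rewrite incl0.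
apply: jacobson_idempotent; last by rewrite -inclM ee.
by apply: IJ => j Jj; rewrite -inclM Je.
Qed.
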